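(* In the affine chart $\mathbb R^2_{z,w}\subset\mathbb{RP}^2$ let $\gamma=\{w=z^2\}$. Every dual billiard structure on $\gamma$ of type 2a) has the rational first integral $$R(z,w)=\frac{(w-z^2)^{2N+1}}{\prod_{j=1}^N(w-c_jz^2)^2},\quad c_j=-\frac{4j(2N+1-j)}{(2N+1-2j)^2},\quad\text{for }\rho=2-\frac2{2N+1};$$ $$R(z,w)=\frac{(w-z^2)^{N+1}}{z\prod_{j=1}^N(w-c_jz^2)},\quad c_j=-\frac{j(2N+2-j)}{(N+1-j)^2},\quad\text{for }\rho=2-\frac1{N+1}.$$ The dual billiards of types 2b1) and 2b2) have respectively the integrals $$R_{b1}(z,w)=\frac{(w-z^2)^2}{(w+3z^2)(z-1)(z-w)},\qquad R_{b2}(z,w)=\frac{(w-z^2)^2}{(z^2+w^2+w+1)(z^2+1)}.$$ The dual billiards of types 2c1) and 2c2) have respectively the integrals $$R_{c1}(z,w)=\frac{(w-z^2)^3}{(1+w^3-2zw)^2},\qquad R_{c2}(z,w)=\frac{(w-z^2)^3}{(8z^3-8z^2w-8z^2-w^2-w+10zw)^2}.$$ The dual billiard of type 2d) has the integral $$R_d(z,w)=\frac{(w-z^2)^3}{(w+8z^2)(z-1)(w+8z^2+4w^2+5wz^2-14zw-4z^3)}.$$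
   Context: For a smooth curve $\gamma\subset\mathbb{RP}^2$ and $P\in\gamma$, $L_P$ is the projective tangent line to $\gamma$ at $P$. A dual billiard structure is a family of non-trivial projective involutions $\sigma_P:L_P\to L_P$ fixing $P$. A rational (first) integral is a non-constant rational function $R$ with $R\circ\sigma_P=R$ on $L_P$ for every $P$. The types of dual billiard structures on $\gamma=\{w=z^2\}$ (punctured at the finitely many points where the formulas are not defined), written at $P=(z_0,z_0^2)\in\gamma$, are: Type 2a): in the coordinate $\zeta=z/z_0$ on $L_P$, $\sigma_P:\zeta\mapsto\frac{(\rho-1)\zeta-(\rho-2)}{\rho\zeta-(\rho-1)}$, where $\rho=2-\frac{2}{2N+1}$ or $\rho=2-\frac1{N+1}$ for some $N\in\mathbb N=\{1,2,\dots\}$. The other types: in the coordinate $u=z-z_0$ on $L_P$, $\sigma_P:u\mapsto-\frac{u}{1+f(z_0)u}$ with type 2b1): $f(z)=\frac{5z-3}{2z(z-1)}$; type 2b2): $f(z)=\frac{3z}{z^2+1}$; type 2c1): $f(z)=\frac{4z^2}{z^3-1}$; type 2c2): $f(z)=\frac{8z-4}{3z(z-1)}$; type 2d): $f(z)=\frac{7z-4}{3z(z-1)}$. *)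

(* Defs.v *)
From HB Require Import structures.
From mathcomp Require Import all_boot all_order all_algebra.
From mathcomp Require Import fraction reals.
From mathcomp.multinomials Require Import mpoly.

Set Implicit Arguments.
Unset Strict Implicit.
Unset Printing Implicit Defensive.

Import Order.TTheory GRing.Theory Num.Theory.
Local Open Scope ring_scope.

Definition hvec (R : realType) (a b c : R) : 'rV[R]_3 :=
  \row_(i < 3) [:: a; b; c]`_i.

(* RP^2 as the set of one-dimensional subspaces of R^3; a projective line is a
   two-dimensional subspace L, and the point p lies on it iff val p <= L. *)
Definition point (R : realType) : Type :=
  {p : {vspace 'rV[R]_3} | \dim p == 1%N}.

Lemma chart_subproof (R : realType) (z w : R) : \dim <[hvec z w 1]> == 1%N.
Proof.
rewrite dim_vline; suff -> : hvec z w 1 != 0 by [].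
apply/eqP => /matrixP /(_ 0 (inord 2)).
by rewrite !mxE inordK //= => /eqP; rewrite oner_eq0.
Qed.

(* The point (z : w : 1). *)
Definition chart (R : realType) (z w : R) : point R :=
  exist _ <[hvec z w 1]>%VS (chart_subproof z w).

Definition on_line (R : realType) (p : point R) (L : {vspace 'rV[R]_3}) : bool :=
  (val p <= L)%VS.

(* Curves are graphs w = g(z); the points of a punctured curve are indexed by
   their abscissas, which range over a domain D. *)
Definition curve_pt (R : realType) (g : {poly R}) (z0 : R) : point R :=
  chart z0 g.[z0].

(* The projective tangent line is spanned by (z0, g(z0), 1) and by the
   derivative of this vector in z0. *)
Definition tangent_line (R : realType) (g : {poly R}) (z0 : R) :
    {vspace 'rV[R]_3} :=
  (<[hvec z0 g.[z0] 1]> + <[hvec 1 g^`().[z0] 0]>)%VS.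

(* The point with abscissa z of the tangent line at abscissa z0. *)
Definition tangent_pt (R : realType) (g : {poly R}) (z0 z : R) : point R :=
  chart z (g.[z0] + g^`().[z0] * (z - z0)).

Definition projective_involution (R : realType) (L : {vspace 'rV[R]_3})
    (s : point R -> point R) : Prop :=
  [/\ exists2 f : 'End('rV[R]_3), (f @: L)%VS = L
        & forall p : point R, on_line p L -> val (s p) = (f @: val p)%VS,
      forall p : point R, on_line p L -> s (s p) = p
    & exists2 p : point R, on_line p L & s p <> p].

(* The map s z0 matters only on the tangent line at abscissa z0, for z0 in D. *)
Definition dual_billiard (R : realType) (g : {poly R}) (D : R -> Prop)
    (s : R -> point R -> point R) : Prop :=
  forall z0 : R, D z0 ->
    projective_involution (tangent_line g z0) (s z0)
    /\ s z0 (curve_pt g z0) = curve_pt g z0.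

(* Rational functions on RP^2, in the affine coordinates z and w. *)
Notation ratfun R := {fraction {mpoly R[2]}}.

Definition rf_const (R : realType) (c : R) : ratfun R := tofrac c%:MP.
Definition rf_z (R : realType) : ratfun R := tofrac 'X_ord0.
Definition rf_w (R : realType) : ratfun R := tofrac 'X_ord_max.

(* A(z, w, 1) *)
Definition dehomogenize (R : realType) (A : {mpoly R[3]}) : {mpoly R[2]} :=
  comp_mpoly [tuple 'X_ord0; 'X_ord_max; 1] A.

(* F is regular at p with value v: near p, F is a quotient A / B of forms of
   the same degree d with B(p) <> 0. *)
Definition has_value (R : realType) (F : ratfun R) (p : point R) (v : R) : Prop :=
  exists (d : nat) (A B : {mpoly R[3]}) (x : 'rV[R]_3),
    [/\ A \is d.-homog, B \is d.-homog,
        F = tofrac (dehomogenize A) / tofrac (dehomogenize B),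
        x != 0 /\ x \in val p
      & B.@[x 0] != 0 /\ v = A.@[x 0] / B.@[x 0]].

(* F o s_P = F on L_P as rational functions on the line L_P: L_P does not lie
   in the polar locus of F, and the two sides agree wherever both are regular,
   that is, at all but finitely many points of L_P. *)
Definition rational_integral (R : realType) (g : {poly R}) (D : R -> Prop)
    (s : R -> point R -> point R) (F : ratfun R) : Prop :=
  (forall c : R, F <> rf_const c) /\
  (forall z0 : R, D z0 ->
     (exists (p : point R) (v : R),
        on_line p (tangent_line g z0) /\ has_value F p v) /\
     (forall (p : point R) (v v' : R), on_line p (tangent_line g z0) ->
        has_value F (s z0 p) v' -> has_value F p v -> v' = v)).

Definition parabola (R : realType) : {poly R} := 'X^2.

Definition domain_2a (R : realType) (z0 : R) : Prop := z0 != 0.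

(* A formula for s z0 in an affine coordinate is required only at the points
   whose image is finite; since s z0 is projective, this determines it on the
   whole line. *)
Definition type_2a (R : realType) (rho : R) (s : R -> point R -> point R) : Prop :=
  [/\ exists2 N : nat, (0 < N)%N
        & rho = 2 - 2 / (2 * N%:R + 1) \/ rho = 2 - 1 / (N%:R + 1),
      dual_billiard (parabola R) (@domain_2a R) s
    & forall z0 zeta : R, domain_2a z0 -> rho * zeta - (rho - 1) != 0 ->
        s z0 (tangent_pt (parabola R) z0 (z0 * zeta)) =
        tangent_pt (parabola R) z0
          (z0 * (((rho - 1) * zeta - (rho - 2)) / (rho * zeta - (rho - 1))))].

(* f = p / q is given by polynomials; the parabola is punctured where q = 0. *)
Definition domain_f (R : realType) (q : {poly R}) (z0 : R) : Prop := q.[z0] != 0.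

Definition type_f (R : realType) (p q : {poly R}) (s : R -> point R -> point R) :
    Prop :=
  dual_billiard (parabola R) (domain_f q) s /\
  forall z0 u : R, domain_f q z0 ->
    let f := p.[z0] / q.[z0] in
    1 + f * u != 0 ->
    s z0 (tangent_pt (parabola R) z0 (z0 + u)) =
    tangent_pt (parabola R) z0 (z0 + (- (u / (1 + f * u)))).

Definition num_2b1 (R : realType) : {poly R} := 5 *: 'X - 3.
Definition den_2b1 (R : realType) : {poly R} := 2 *: 'X * ('X - 1).
Definition type_2b1 (R : realType) (s : R -> point R -> point R) : Prop :=
  type_f (num_2b1 R) (den_2b1 R) s.

Definition num_2b2 (R : realType) : {poly R} := 3 *: 'X.
Definition den_2b2 (R : realType) : {poly R} := 'X^2 + 1.
Definition type_2b2 (R : realType) (s : R -> point R -> point R) : Prop :=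
  type_f (num_2b2 R) (den_2b2 R) s.

Definition num_2c1 (R : realType) : {poly R} := 4 *: 'X^2.
Definition den_2c1 (R : realType) : {poly R} := 'X^3 - 1.
Definition type_2c1 (R : realType) (s : R -> point R -> point R) : Prop :=
  type_f (num_2c1 R) (den_2c1 R) s.

Definition num_2c2 (R : realType) : {poly R} := 8 *: 'X - 4.
Definition den_2c2 (R : realType) : {poly R} := 3 *: 'X * ('X - 1).
Definition type_2c2 (R : realType) (s : R -> point R -> point R) : Prop :=
  type_f (num_2c2 R) (den_2c2 R) s.

Definition num_2d (R : realType) : {poly R} := 7 *: 'X - 4.
Definition den_2d (R : realType) : {poly R} := 3 *: 'X * ('X - 1).
Definition type_2d (R : realType) (s : R -> point R -> point R) : Prop :=
  type_f (num_2d R) (den_2d R) s.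

(* Main.v *)
Require Import Defs.
From HB Require Import structures.
From mathcomp Require Import all_boot all_order all_algebra.
From mathcomp Require Import fraction reals ring lra zify.
From mathcomp.multinomials Require Import mpoly.

Set Implicit Arguments.
Unset Strict Implicit.
Unset Printing Implicit Defensive.

Import Order.TTheory GRing.Theory Num.Theory.
Local Open Scope ring_scope.

(** The tangent line at P = (z0, z0^2) is parametrized homogeneously by
    [tvec z0 a b] with u = z - z0 = a / b, and the involution becomes
    (a, b) |-> (- a, b + f(z0) a); a type 2a structure is the case f = rho / z0.
    On this line the form w t - z^2 restricts to - a^2, which is invariant, so
    each claim reduces to invariance of the homogenized denominator E.  For the
    types 2b-2d this is a polynomial identity.  For type 2a, rho = 2 - 2 / S
    with S = 2N + 1 or S = 2N + 2, and E splits on the line into powers of the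
    S linear forms z0 b + (2k / S) a, k < S, which the involution permutes by
    k |-> S - 1 - k. *)

(** * Forms in several variables: scaling, vanishing and degrees *)

Section Homogeneous.
Variables (n : nat) (R : realType).
Implicit Types (A : {mpoly R[n]}) (x y : 'I_n -> R).

Lemma meval_homog d A (c : R) x y :
  A \is d.-homog -> (forall i, y i = c * x i) -> A.@[y] = c ^+ d * A.@[x].
Proof.
move=> hA hy; rewrite !mevalE mulr_sumr.
rewrite big_seq [RHS]big_seq; apply: eq_bigr => m hm.
rewrite -(dhomog_mf hA hm) /= mdegE -prodrXr mulrCA; congr (_ * _).
by rewrite -big_split /=; apply: eq_bigr => i _; rewrite hy exprMn.
Qed.

(* By continuity along the line through y in the direction of the i-th axis. *)
Lemma meval_eq0_coord A (i : 'I_n) :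
  (forall x, x i != 0 -> A.@[x] = 0) -> forall x, A.@[x] = 0.
Proof.
move=> hA x; have [xi0|] := eqVneq (x i) 0; last exact: hA.
pose l (t : R) j := x j + (if j == i then t else 0).
(* [P] is [A] restricted to that line, as a polynomial in the parameter t. *)
pose P : {poly R} :=
  mmap (@polyC R) (fun j => (x j)%:P + (if j == i then 'X else 0)) A.
have PE t : P.[t] = A.@[l t].
  rewrite /P /mmap /meval /mmap horner_sum; apply: eq_bigr => m _.
  rewrite hornerM hornerC; congr (_ * _).
  rewrite /mmap1 horner_prod; apply: eq_bigr => j _.
  by rewrite horner_exp hornerD hornerC /l; case: eqP; rewrite ?hornerX ?horner0.
have P0 : P = 0.
  apply/eqP; case: (eqVneq P 0) => // nzP.
  (* The nodes 1, ..., [size P] are nonzero, so the hypothesis makes each a root of [P]; a nonzero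
     [P] has fewer roots than [size P]. *)
  pose rs := [seq (k.+1%:R : R) | k <- iota 0 (size P)].
  have /(max_poly_roots nzP) : all (root P) rs.
    apply/allP => _ /mapP[k _ ->]; rewrite rootE PE hA //.
    by rewrite /l eqxx xi0 add0r pnatr_eq0.
  rewrite map_inj_uniq ?iota_uniq; last by move=> a b /eqP; rewrite eqr_nat => /eqP [].
  by rewrite size_map size_iota ltnn => /(_ isT).
have := PE 0; rewrite P0 horner0 => /esym <-.
by apply: meval_eq => j; rewrite /l; case: ifP; rewrite addr0.
Qed.

Lemma homogD d A B :
  A \is d.-homog -> B \is d.-homog -> A + B \is d.-homog.
Proof. exact: rpredD. Qed.

Lemma homogN d A : A \is d.-homog -> - A \is d.-homog.
Proof. by move=> hA; rewrite rpredN. Qed.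

Lemma homogMn d A k : A \is d.-homog -> A *+ k \is d.-homog.
Proof. by move=> hA; exact: rpredMn. Qed.

Lemma homogZ d (c : R) A : A \is d.-homog -> c *: A \is d.-homog.
Proof. by move=> hA; exact: rpredZ. Qed.

(** The total degree is kept as an equation, so that [solve_homog] finds the degrees of the factors
    by unification and checks the sum by computation. *)
Lemma homogM_eq d e k A B :
  A \is d.-homog -> B \is e.-homog -> (d + e)%N = k -> A * B \is k.-homog.
Proof. by move=> hA hB <-; exact: dhomogM. Qed.

Lemma homogX_eq d e k A :
  A \is d.-homog -> (d * e)%N = k -> A ^+ e \is k.-homog.
Proof. by move=> hA <-; exact: dhomogMn. Qed.

Lemma homogXU_eq i k : 1%N = k -> ('X_i : {mpoly R[n]}) \is k.-homog.
Proof. by move=> <-; rewrite dhomogX /= mdeg1. Qed.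

Lemma homog_prod_nat d N (F : nat -> {mpoly R[n]}) :
  (forall j, F j \is d.-homog) ->
  \prod_(1 <= j < N.+1) F j \is (d * N).-homog.
Proof.
move=> hF; elim: N => [|N IH].
  by rewrite big_geq // muln0 dhomog1.
by rewrite big_nat_recr //= mulnSr; exact: dhomogM.
Qed.

End Homogeneous.

Ltac solve_homog :=
  lazymatch goal with
  | |- is_true (_ + _ \is _) => eapply homogD; solve_homog
  | |- is_true (- _ \is _) => eapply homogN; solve_homog
  | |- is_true (_ *+ _ \is _) => eapply homogMn; solve_homog
  | |- is_true (_ *: _ \is _) => eapply homogZ; solve_homog
  | |- is_true (_ ^+ _ \is _) =>
      eapply homogX_eq; [solve_homog | reflexivity]
  | |- is_true (_ * _ \is _) =>
      eapply homogM_eq; [solve_homog | solve_homog | reflexivity]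
  | |- _ => eapply homogXU_eq; reflexivity
  end.

(** * Forms of degree d in three variables against their values in the chart *)

Section Chart.
Variable R : realType.
Implicit Types (A : {mpoly R[3]}) (a b c : R).

Local Notation X0 := ('X_(0 : 'I_3) : {mpoly R[3]}).
Local Notation X1 := ('X_(1 : 'I_3) : {mpoly R[3]}).
Local Notation X2 := ('X_(ord_max : 'I_3) : {mpoly R[3]}).

Lemma meval_dehomogenize A (v : 'I_2 -> R) :
  (dehomogenize A).@[v] = A.@[hvec (v ord0) (v ord_max) 1 0].
Proof.
rewrite /dehomogenize comp_mpoly_meval; apply: meval_eq => i.
rewrite (tnth_nth 0) mxE.
by case: i => [[|[|[|//]]]] ? /=; rewrite ?mevalXU ?meval1.
Qed.

(** Off the line at infinity, scaling by the last coordinate recovers [A] from its values in the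
    chart; the points at infinity follow by [meval_eq0_coord]. *)
Lemma dehomogenize_eq0 d A :
  A \is d.-homog -> dehomogenize A = 0 -> forall x, A.@[x] = 0.
Proof.
move=> hA A0; apply: (@meval_eq0_coord _ _ _ ord_max) => x x2.
pose v (i : 'I_2) := [:: x 0 / x ord_max; x 1 / x ord_max]`_i.
have := meval_dehomogenize A v; rewrite A0 meval0 => hv.
rewrite (meval_homog (c := x ord_max) (x := hvec (v ord0) (v ord_max) 1 0) hA).
  by rewrite -hv mulr0.
move=> i; rewrite mxE /v /=.
case: i => [[|[|[|//]]]] hi /=; rewrite ?mulr1 ?[_ * (_ / _)]mulrC ?divfK //;
  by congr x; apply: val_inj.
Qed.

(** The nonzero value at [y] keeps the dehomogenization of [B] nonzero, so the fractions can be
    cross-multiplied. The difference of the two products is a form of degree d + k that vanishes in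
    the chart, hence everywhere. *)
Lemma frac_homog d k A B N E (y : 'I_3 -> R) :
    A \is d.-homog -> B \is d.-homog -> N \is k.-homog -> E \is k.-homog ->
    dehomogenize E != 0 ->
    B.@[y] != 0 ->
    tofrac (dehomogenize N) / tofrac (dehomogenize E) =
      tofrac (dehomogenize A) / tofrac (dehomogenize B) ->
  forall x, A.@[x] * E.@[x] = B.@[x] * N.@[x].
Proof.
move=> hA hB hN hE nzE nzBy /eqP.
have nzB : dehomogenize B != 0.
  by apply: contraNneq nzBy => /(dehomogenize_eq0 hB) ->.
rewrite eqr_div ?tofrac_eq0 // -!tofracM tofrac_eq => /eqP h x.
apply/eqP; rewrite -subr_eq0 -!mevalM -mevalB.
rewrite (@dehomogenize_eq0 (d + k)) //.
  by apply: rpredB; apply: dhomogM.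
by rewrite /dehomogenize rmorphB !rmorphM /= -/(dehomogenize _) [X in _ - X]mulrC h subrr.
Qed.

(** * Homogeneous parameters on a tangent line: (0, 1) is the tangency point, b = 0 the point at
    infinity *)

Definition tvec (z0 a b : R) : 'rV[R]_3 :=
  hvec (b * z0 + a) (b * z0 ^+ 2 + 2 * z0 * a) b.

Lemma tvecE (z0 a b c a' b' : R) : c *: tvec z0 a b + tvec z0 a' b' =
  tvec z0 (c * a + a') (c * b + b').
Proof.
apply/rowP => i; rewrite !mxE.
by case: i => [[|[|[|//]]]] ? /=; ring.
Qed.

Lemma tvecZ (z0 : R) a b c : c *: tvec z0 a b = tvec z0 (c * a) (c * b).
Proof.
apply/rowP => i; rewrite !mxE.
by case: i => [[|[|[|//]]]] ? /=; ring.
Qed.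

Lemma tvec_inj (z0 a b a' b' : R) : tvec z0 a b = tvec z0 a' b' -> a = a' /\ b = b'.
Proof.
move=> /rowP h; have := h 0; have := h ord_max; rewrite !mxE /= => -> /addrI.
by [].
Qed.

Lemma tvec_eq0 z0 a b : (tvec z0 a b == 0) = (a == 0) && (b == 0).
Proof.
have t0 : tvec z0 0 0 = 0 by have := tvecZ z0 0 0 0; rewrite scale0r !mul0r.
apply/eqP/andP => [|[/eqP -> /eqP ->] //].
by rewrite -t0 => /tvec_inj[-> ->].
Qed.

Lemma horner_parabola (z0 : R) : (parabola R).[z0] = z0 ^+ 2.
Proof. by rewrite /parabola hornerXn. Qed.

Lemma horner_deriv_parabola (z0 : R) : (parabola R)^`().[z0] = 2 * z0.
Proof. by rewrite /parabola derivXn hornerMn hornerXn expr1 mulr_natl. Qed.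

Lemma tangent_lineP (z0 : R) (x : 'rV[R]_3) :
  reflect (exists a b, x = tvec z0 a b) (x \in tangent_line (parabola R) z0).
Proof.
rewrite /tangent_line horner_parabola horner_deriv_parabola.
have e0 : hvec z0 (z0 ^+ 2) 1 = tvec z0 0 1.
  by congr hvec; ring.
have e1 : hvec 1 (2 * z0) 0 = tvec z0 1 0.
  by congr hvec; ring.
rewrite e0 e1; apply: (iffP memv_addP).
  move=> [_ /vlineP[b ->] [_ /vlineP[a ->] ->]].
  exists a, b; rewrite [X in _ + X]tvecZ tvecE; congr tvec; ring.
move=> [a [b ->]]; exists (b *: tvec z0 0 1); first by rewrite memvZ ?memv_line.
exists (a *: tvec z0 1 0); first by rewrite memvZ ?memv_line.
by rewrite [X in _ + X]tvecZ tvecE; congr tvec; ring.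
Qed.

Lemma val_tangent_pt (z0 : R) u :
  val (tangent_pt (parabola R) z0 (z0 + u)) = <[tvec z0 u 1]>%VS.
Proof.
rewrite /= horner_parabola horner_deriv_parabola.
by congr (<[hvec _ _ _]>%VS); ring.
Qed.

Lemma point_vline (p : point R) x : x != 0 -> x \in val p -> val p = <[x]>%VS.
Proof.
move=> nzx xp; apply/eqP; rewrite eq_sym eqEdim -memvE xp dim_vline nzx.
by rewrite (eqP (valP p)).
Qed.

Lemma point_neq0 (p : point R) x : val p = <[x]>%VS -> x != 0.
Proof.
by move=> px; have := valP p; rewrite px dim_vline; rewrite eqb1.
Qed.

Lemma tangent_point (z0 : R) (p : point R) x :
    on_line p (tangent_line (parabola R) z0) -> x != 0 -> x \in val p ->
  exists a b, x = tvec z0 a b.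
Proof. by move=> /subvP pL _ xp; apply/tangent_lineP; exact: pL. Qed.

Lemma on_tangent (z0 : R) a b (p : point R) :
  val p = <[tvec z0 a b]>%VS -> on_line p (tangent_line (parabola R) z0).
Proof.
by move=> hp; rewrite /on_line hp -memvE; apply/tangent_lineP; exists a, b.
Qed.

(** The hypothesis is a quadratic identity in u away from the pole -1/f, so three values of u
    determine it. The values 0, 1, -1 serve unless f = 1 or f = -1, when the one that is the pole is
    replaced by -2 or 2. *)
Lemma homography_coef (f a0 a1 b0 b1 : R) :
    (forall u, 1 + f * u != 0 ->
       (u * a1 + a0) * (1 + f * u) = - u * (u * b1 + b0)) ->
  [/\ a0 = 0, b0 = - a1 & b1 = - (f * a1)].
Proof.
move=> quad.
have a00 : a0 = 0.
  by have := quad 0; rewrite mulr0 addr0 oner_neq0 => /(_ isT); lra.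
subst a0; case: (eqVneq f 1) => [f1|nf1]; [|case: (eqVneq f (-1)) => [f1|nf1']].
- have := quad 1; have := quad (-2); rewrite f1.
  have -> : 1 + 1 * -2 != 0 :> R by lra.
  have -> : 1 + 1 * 1 != 0 :> R by lra.
  by move=> /(_ isT) h1 /(_ isT) h2; split; lra.
- have := quad (-1); have := quad 2; rewrite f1.
  have -> : 1 + -1 * 2 != 0 :> R by lra.
  have -> : 1 + -1 * -1 != 0 :> R by lra.
  by move=> /(_ isT) h1 /(_ isT) h2; split; lra.
- have := quad (-1); have := quad 1.
  have -> : 1 + f * 1 != 0 :> R by apply/eqP => h; case/eqP: nf1'; lra.
  have -> : 1 + f * -1 != 0 :> R by apply/eqP => h; case/eqP: nf1; lra.
  by move=> /(_ isT) h1 /(_ isT) h2; split; lra.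
Qed.

(** The affine formula speaks only of finite points with finite images. Since [s] is induced by a
    linear map, these points fix that map on the tangent plane up to a scalar, which gives the
    formula on the whole projective line. *)
Lemma involution_tvec (z0 : R) f s :
    projective_involution (tangent_line (parabola R) z0) s ->
    (forall u, 1 + f * u != 0 ->
       s (tangent_pt (parabola R) z0 (z0 + u)) =
       tangent_pt (parabola R) z0 (z0 + - (u / (1 + f * u)))) ->
  forall p a b, val p = <[tvec z0 a b]>%VS ->
    val (s p) = <[tvec z0 (- a) (b + f * a)]>%VS.
Proof.
move=> [[g gL hg] _ _] hs.
have gt a b : exists a' b', g (tvec z0 a b) = tvec z0 a' b'.
  apply/tangent_lineP; rewrite -gL memv_img //.
  by apply/tangent_lineP; exists a, b.
have [a0 [b0 g0]] := gt 0 1; have [a1 [b1 g1]] := gt 1 0.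
have gE a b : g (tvec z0 a b) = tvec z0 (a * a1 + b * a0) (a * b1 + b * b0).
  have -> : tvec z0 a b = a *: tvec z0 1 0 + b *: tvec z0 0 1.
    by rewrite [X in _ + X]tvecZ tvecE; congr tvec; ring.
  by rewrite linearD !linearZ /= g0 g1 [X in _ + X]tvecZ tvecE.
have quad u : 1 + f * u != 0 -> (u * a1 + a0) * (1 + f * u) = - u * (u * b1 + b0).
  move=> nz; have := congr1 val (hs u nz).
  rewrite hg; last exact: on_tangent (val_tangent_pt z0 u).
  rewrite !val_tangent_pt limg_line gE => h.
  have /vlineP[k] : tvec z0 (u * a1 + 1 * a0) (u * b1 + 1 * b0) \in
      <[tvec z0 (- (u / (1 + f * u))) 1]>%VS by rewrite -h memv_line.
  rewrite tvecZ => /tvec_inj[]; rewrite !mul1r mulr1 => -> ->.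
  by field.
have [a00 b00 b10] := homography_coef quad.
move=> p a b hp; have := hg p (on_tangent hp).
rewrite hp limg_line gE => sp; have nz := point_neq0 sp.
apply: point_vline; last first.
  (* With these coefficients [g] is -a1 times the claimed map, and a1 = 0 would send the vector of
     [p] to zero. *)
  rewrite sp; apply/vlineP; exists (- a1^-1).
  have nza1 : a1 != 0.
    apply: contraNneq nz => a10; rewrite tvec_eq0 b00 b10 a00 a10.
    by apply/andP; split; apply/eqP; ring.
  by rewrite tvecZ b00 b10 a00; congr tvec; field.
apply: contraNneq (point_neq0 hp) => /eqP; rewrite !tvec_eq0 oppr_eq0.
by move=> /andP[/eqP ->]; rewrite mulr0 addr0 eqxx.
Qed.

(** * A criterion for integrals whose numerator is a power of the conic *)

Definition conic : {mpoly R[3]} := X1 * X2 - X0 ^+ 2.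

Lemma conic_homog n : conic ^+ n \is (2 * n).-homog.
Proof. by rewrite /conic; solve_homog. Qed.

Lemma meval_conic n (z0 : R) a b :
  (conic ^+ n).@[tvec z0 a b 0] = (- a ^+ 2) ^+ n.
Proof.
rewrite rmorphXn /= /conic mevalB mevalM rmorphXn /= !mevalXU !mxE /=.
by congr (_ ^+ n); ring.
Qed.

(** A value may be witnessed by a quotient A / B other than N / E. [frac_homog] transfers it to N /
    E, and the product form keeps its meaning where [E] vanishes. *)
Lemma has_value_frac k N E F (p : point R) v x :
    N \is k.-homog -> E \is k.-homog ->
    F = tofrac (dehomogenize N) / tofrac (dehomogenize E) ->
    dehomogenize E != 0 -> val p = <[x]>%VS ->
    has_value F p v -> v * E.@[x 0] = N.@[x 0].
Proof.
move=> hN hE -> nzE px [d [A [B [y [hA hB h [nzy yp] [nzB ->]]]]]].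
have /= hx := frac_homog hA hB hN hE nzE nzB h (y 0).
move: yp; rewrite px => /vlineP[c yE].
have yE' i : y 0 i = c * x 0 i by rewrite yE mxE.
have nzc : c != 0 by apply: contraNneq nzy => c0; rewrite yE c0 scale0r.
move: hx; rewrite (meval_homog hE yE') (meval_homog hN yE') => hx.
apply: (mulfI (expf_neq0 k nzc)); apply: (mulfI nzB).
by rewrite -hx; field.
Qed.

(* The conic vanishes on the tangent line only at the tangency point, so the
   numerator and E never vanish together there and E governs regularity. *)
Lemma rational_integral_conic (D : R -> Prop) (s : R -> point R -> point R)
    (f : R -> R) n E :
    (0 < n)%N -> E \is (2 * n).-homog -> (exists z0, D z0) ->
    (forall z0, D z0 ->
       projective_involution (tangent_line (parabola R) z0) (s z0)) ->
    (forall z0 u, D z0 -> 1 + f z0 * u != 0 ->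
       s z0 (tangent_pt (parabola R) z0 (z0 + u)) =
       tangent_pt (parabola R) z0 (z0 + - (u / (1 + f z0 * u)))) ->
    (forall z0, D z0 -> E.@[tvec z0 0 1 0] != 0) ->
    (forall z0 a b, D z0 ->
       E.@[tvec z0 (- a) (b + f z0 * a) 0] = E.@[tvec z0 a b 0]) ->
  rational_integral (parabola R) D s
    (tofrac (dehomogenize (conic ^+ n)) / tofrac (dehomogenize E)).
Proof.
move=> n0 hE [z1 Dz1] hinv hs nzE invE.
have nzP z0 : tvec z0 0 1 != 0 by rewrite tvec_eq0 oner_eq0 andbF.
have nzdE : dehomogenize E != 0.
  by apply: contraNneq (nzE _ Dz1) => /(dehomogenize_eq0 hE) ->.
(* At the tangency point the numerator vanishes and [E] does not, so the tangent line is not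
   contained in the polar locus. *)
have hvalP z0 : D z0 -> has_value (tofrac (dehomogenize (conic ^+ n)) /
    tofrac (dehomogenize E)) (curve_pt (parabola R) z0) 0.
  move=> Dz0; exists (2 * n)%N, (conic ^+ n), E, (tvec z0 0 1).
  split=> //; first exact: conic_homog.
    split=> //; rewrite /curve_pt /= horner_parabola.
    by rewrite /tvec mulr0 mul1r !addr0 mul1r memv_line.
  by split; [exact: nzE | rewrite meval_conic expr0n oppr0 expr0n eqn0Ngt n0 mul0r].
(* Evaluating at a tangency point forces a constant value to be 0, whereas the power of the conic is
   a nonzero form. *)
split=> [c h|z0 Dz0].
  have nzdN : dehomogenize (conic ^+ n) != 0.
    apply: contraNneq (oner_neq0 R) => /(dehomogenize_eq0 (conic_homog n)) h0.
    have := h0 (tvec 0 1 0 0); rewrite meval_conic expr1n => /eqP.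
    by rewrite expf_eq0 n0 oppr_eq0 => /eqP ->.
  have /eqP := h; rewrite -[X in _ == X]divr1 eqr_div ?tofrac_eq0 ?oner_eq0 //.
  rewrite mulr1 -tofracM tofrac_eq => /eqP hN.
  have := congr1 (meval (fun i : 'I_2 => [:: z1; z1 ^+ 2]`_i)) hN.
  rewrite mevalM mevalC !meval_dehomogenize /=.
  have -> : hvec z1 (z1 ^+ 2) 1 = tvec z1 0 1 by congr hvec; ring.
  rewrite meval_conic expr0n oppr0 expr0n eqn0Ngt n0 => /esym/eqP.
  rewrite mulf_eq0 (negPf (nzE _ Dz1)) orbF => /eqP c0.
  by move: nzdN; rewrite hN c0 mpolyC0 mul0r eqxx.
split.
  exists (curve_pt (parabola R) z0), 0; split; last exact: hvalP.
  apply: (@on_tangent _ 0 1); rewrite /= horner_parabola.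
  by congr (<[hvec _ _ _]>%VS); ring.
move=> p v v' pL hv' hv.
have [x nzx xp] : exists2 x, x != 0 & x \in val p.
  exists (vpick (val p)); last exact: memv_pick.
  by rewrite vpick0 -dimv_eq0 (eqP (valP p)).
have [a [b xE]] := tangent_point pL nzx xp.
have px : val p = <[tvec z0 a b]>%VS by rewrite -xE; exact: point_vline.
have spx := involution_tvec (hinv _ Dz0) (fun u => hs z0 u Dz0) px.
have hEv := has_value_frac (conic_homog n) hE erefl nzdE px hv.
have := has_value_frac (conic_homog n) hE erefl nzdE spx hv'.
rewrite invE // meval_conic sqrrN -(meval_conic n z0 a b) -hEv.
(* Both values solve the same equation v E = N, so it remains to cancel [E]. If [E] vanished at x,
   so would the conic; then a = 0, and x would be a multiple of the tangency vector, where [E] is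
   nonzero. *)
apply: mulIf; apply: contraNneq (point_neq0 px) => Ex0.
move: hEv; rewrite Ex0 mulr0 meval_conic => /esym/eqP.
rewrite expf_eq0 n0 oppr_eq0 sqrf_eq0 => /eqP a0.
rewrite tvec_eq0 a0 eqxx /=; move/eqP: Ex0; rewrite a0.
rewrite (@meval_homog _ _ (2 * n) _ b (tvec z0 0 1 0)) //.
  by rewrite mulf_eq0 (negPf (nzE _ Dz0)) orbF expf_eq0 => /andP[].
by move=> i; have /rowP/(_ i) := tvecZ z0 0 1 b; rewrite mulr0 mulr1 => <-; rewrite mxE.
Qed.

End Chart.

(** * From forms to rational functions in z and w *)

Section Integrals.
Variable R : realType.
Implicit Types (A B : {mpoly R[3]}) (s : R -> point R -> point R).

Local Notation X0 := ('X_(0 : 'I_3) : {mpoly R[3]}).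
Local Notation X1 := ('X_(1 : 'I_3) : {mpoly R[3]}).
Local Notation X2 := ('X_(ord_max : 'I_3) : {mpoly R[3]}).

Definition affine A : ratfun R := tofrac (dehomogenize A).

(** In this and the next lemmas the values of the parts are separate equations, so that
    [eval_affine] builds the rational function by unification along the shape of the form. *)
Lemma affineD A B a b : affine A = a -> affine B = b -> affine (A + B) = a + b.
Proof. by move=> <- <-; rewrite /affine /dehomogenize comp_mpolyD tofracD. Qed.

Lemma affineN A a : affine A = a -> affine (- A) = - a.
Proof. by move=> <-; rewrite /affine /dehomogenize comp_mpolyN tofracN. Qed.

Lemma affineM A B a b : affine A = a -> affine B = b -> affine (A * B) = a * b.
Proof. by move=> <- <-; rewrite /affine /dehomogenize rmorphM /= tofracM. Qed.

Lemma affineXn k A a : affine A = a -> affine (A ^+ k) = a ^+ k.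
Proof. by move=> <-; rewrite /affine /dehomogenize rmorphXn /= tofracXn. Qed.

Lemma affineMn k A a : affine A = a -> affine (A *+ k) = k%:R * a.
Proof.
by move=> <-; rewrite /affine /dehomogenize comp_mpolyMn tofracMn mulr_natl.
Qed.

Lemma affineZ c A a : affine A = a -> affine (c *: A) = rf_const c * a.
Proof.
by move=> <-; rewrite /affine /dehomogenize comp_mpolyZ -mul_mpolyC tofracM.
Qed.

Lemma affine_prod N (F : nat -> {mpoly R[3]}) G :
    (forall j, affine (F j) = G j) ->
  affine (\prod_(1 <= j < N.+1) F j) = \prod_(1 <= j < N.+1) G j.
Proof.
move=> FG; elim: N => [|N IH].
  by rewrite !big_geq // /affine /dehomogenize comp_mpoly1 tofrac1.
by rewrite !(@big_nat_recr _ _ _ N.+1) //=; exact: affineM.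
Qed.

Lemma affineX0 : affine X0 = rf_z R.
Proof. by rewrite /affine /dehomogenize comp_mpolyXU. Qed.

Lemma affineX1 : affine X1 = rf_w R.
Proof. by rewrite /affine /dehomogenize comp_mpolyXU. Qed.

Lemma affineX2 : affine X2 = 1.
Proof. by rewrite /affine /dehomogenize comp_mpolyXU /= tofrac1. Qed.

Ltac eval_affine :=
  lazymatch goal with
  | |- affine (_ + _) = _ => eapply affineD; eval_affine
  | |- affine (- _) = _ => eapply affineN; eval_affine
  | |- affine (_ *+ _) = _ => eapply affineMn; eval_affine
  | |- affine (_ *: _) = _ => eapply affineZ; eval_affine
  | |- affine (_ ^+ _) = _ => eapply affineXn; eval_affine
  | |- affine (_ * _) = _ => eapply affineM; eval_affine
  | |- affine 'X_ord_max = _ => exact affineX2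
  | |- _ => first [exact affineX0 | exact affineX1]
  end.

Lemma meval_prod_nat (v : 'I_3 -> R) N (F : nat -> {mpoly R[3]}) :
  (\prod_(1 <= j < N.+1) F j).@[v] = \prod_(1 <= j < N.+1) (F j).@[v].
Proof. exact: rmorph_prod. Qed.

Lemma mevalXn (v : 'I_3 -> R) k A : (A ^+ k).@[v] = A.@[v] ^+ k.
Proof. exact: rmorphXn. Qed.

Definition meval_simp := (mevalD, mevalN, mevalM, mevalXn, mevalMn, mevalZ,
  mevalXU, meval_prod_nat).

Ltac eval_simp := rewrite !meval_simp /tvec !mxE /=.

Lemma affine_conic n : affine (conic R ^+ n) = (rf_w R - rf_z R ^+ 2) ^+ n.
Proof.
by apply: affineXn; rewrite /conic; etransitivity; [eval_affine | rewrite mulr1].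
Qed.

(** The criterion with f = p / q. The condition at 2 makes the domain nonempty: the denominators of
    types 2b to 2d are all nonzero there. *)
Lemma type_f_integral (p q : {poly R}) s n E (F : ratfun R) :
    (0 < n)%N -> E \is (2 * n).-homog -> q.[2] != 0 ->
    (forall z0, q.[z0] != 0 -> E.@[tvec z0 0 1 0] != 0) ->
    (forall z0 a b, q.[z0] != 0 ->
       E.@[tvec z0 (- a) (b + p.[z0] / q.[z0] * a) 0] = E.@[tvec z0 a b 0]) ->
    F = affine E ->
  type_f p q s ->
  rational_integral (parabola R) (domain_f q) s
    ((rf_w R - rf_z R ^+ 2) ^+ n / F).
Proof.
move=> n0 hE q2 nzE invE -> [hs hs']; rewrite -affine_conic.
apply: (@rational_integral_conic _ _ _ (fun z0 => p.[z0] / q.[z0])) => //.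
- by exists 2.
- by move=> z0 Dz0; have [] := hs z0 Dz0.
Qed.

(** * Types 2b, 2c and 2d: explicit polynomial identities *)

Lemma horner_den_2b1 (x : R) : (den_2b1 R).[x] = 2 * x * (x - 1).
Proof. by rewrite /den_2b1 !hornerE. Qed.

Lemma horner_num_2b1 (x : R) : (num_2b1 R).[x] = 5 * x - 3.
Proof. by rewrite /num_2b1 hornerD hornerN hornerMn !hornerE. Qed.

Lemma horner_den_2b2 (x : R) : (den_2b2 R).[x] = x ^+ 2 + 1.
Proof. by rewrite /den_2b2 !hornerE. Qed.

Lemma horner_num_2b2 (x : R) : (num_2b2 R).[x] = 3 * x.
Proof. by rewrite /num_2b2 !hornerE. Qed.

Lemma horner_den_2c1 (x : R) : (den_2c1 R).[x] = x ^+ 3 - 1.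
Proof. by rewrite /den_2c1 !hornerE. Qed.

Lemma horner_num_2c1 (x : R) : (num_2c1 R).[x] = 4 * x ^+ 2.
Proof. by rewrite /num_2c1 !hornerE. Qed.

Lemma horner_den_2c2 (x : R) : (den_2c2 R).[x] = 3 * x * (x - 1).
Proof. by rewrite /den_2c2 !hornerE. Qed.

Lemma horner_num_2c2 (x : R) : (num_2c2 R).[x] = 8 * x - 4.
Proof. by rewrite /num_2c2 hornerD hornerN hornerMn !hornerE. Qed.

Lemma horner_den_2d (x : R) : (den_2d R).[x] = 3 * x * (x - 1).
Proof. exact: horner_den_2c2. Qed.

Lemma horner_num_2d (x : R) : (num_2d R).[x] = 7 * x - 4.
Proof. by rewrite /num_2d hornerD hornerN hornerMn !hornerE. Qed.

Definition horner_simp := (horner_den_2b1, horner_num_2b1, horner_den_2b2,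
  horner_num_2b2, horner_den_2c1, horner_num_2c1, horner_den_2c2,
  horner_num_2c2, horner_den_2d,
  horner_num_2d).

Local Notation z := (rf_z R).
Local Notation w := (rf_w R).

(** Allows the value of the denominator on the parabola to be supplied in factored form and checked
    by [ring]; its zeros are then seen to be punctures. *)
Lemma eq_neq0 (x y : R) : y != 0 -> x = y -> x != 0.
Proof. by move=> ? ->. Qed.

Lemma cubic_den_neq0 (c x : R) : c * x * (x - 1) != 0 -> x != 0 /\ x - 1 != 0.
Proof. by rewrite !mulf_eq0 !negb_or => /andP[/andP[_ ->] ->]. Qed.

Lemma integral_2b1 s : type_2b1 s ->
  rational_integral (parabola R) (domain_f (den_2b1 R)) s
    ((w - z ^+ 2) ^+ 2 / ((w + 3 * z ^+ 2) * (z - 1) * (z - w))).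
Proof.
apply: (@type_f_integral _ _ _ _
  ((X1 * X2 + X0 ^+ 2 *+ 3) * (X0 - X2) * (X0 - X1))) => //.
- by solve_homog.
- by rewrite horner_simp; apply: lt0r_neq0; lra.
- move=> x; rewrite horner_simp => nz; eval_simp.
  have [x0 x1]  := cubic_den_neq0 nz.
  apply: (@eq_neq0 _ (- (4 * x ^+ 3 * (x - 1) ^+ 2))); last by ring.
  by rewrite !(oppr_eq0, mulf_eq0, expf_eq0, pnatr_eq0, negb_or) /= ?x0 ?x1.
- move=> x a b; rewrite !horner_simp => nz; eval_simp.
  have [x0 x1]  := cubic_den_neq0 nz.
  by field; rewrite ?x0 ?x1.
- symmetry; etransitivity; [eval_affine | rewrite ?expr1n !mulr1 ?mulrA //].
Qed.

Lemma integral_2b2 s : type_2b2 s ->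
  rational_integral (parabola R) (domain_f (den_2b2 R)) s
    ((w - z ^+ 2) ^+ 2 / ((z ^+ 2 + w ^+ 2 + w + 1) * (z ^+ 2 + 1))).
Proof.
apply: (@type_f_integral _ _ _ _
  ((X0 ^+ 2 + X1 ^+ 2 + X1 * X2 + X2 ^+ 2) * (X0 ^+ 2 + X2 ^+ 2))) => //.
- by solve_homog.
- by rewrite horner_simp; apply: lt0r_neq0; lra.
- move=> x; rewrite horner_simp => nz; eval_simp.
  (* On the parabola the first factor is the square of the second. *)
  apply: (@eq_neq0 _ ((x ^+ 2 + 1) ^+ 3)); last by ring.
  by rewrite !(oppr_eq0, mulf_eq0, expf_eq0, pnatr_eq0, negb_or) /= ?nz.
- move=> x a b; rewrite !horner_simp => nz; eval_simp.
  by field; rewrite nz.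
- symmetry; etransitivity; [eval_affine | rewrite ?expr1n !mulr1 ?mulrA //].
Qed.

Lemma integral_2c1 s : type_2c1 s ->
  rational_integral (parabola R) (domain_f (den_2c1 R)) s
    ((w - z ^+ 2) ^+ 3 / (1 + w ^+ 3 - 2 * z * w) ^+ 2).
Proof.
apply: (@type_f_integral _ _ _ _
  ((X2 ^+ 3 + X1 ^+ 3 - (X0 * X1 * X2) *+ 2) ^+ 2)) => //.
- by solve_homog.
- by rewrite horner_simp; apply: lt0r_neq0; lra.
- move=> x; rewrite horner_simp => nz; eval_simp.
  (* On the parabola the cubic itself is already the square of x^3 - 1. *)
  apply: (@eq_neq0 _ ((x ^+ 3 - 1) ^+ 4)); last by ring.
  by rewrite !(oppr_eq0, mulf_eq0, expf_eq0, pnatr_eq0, negb_or) /= ?nz.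
- move=> x a b; rewrite !horner_simp => nz; eval_simp.
  by field; rewrite nz.
- symmetry; etransitivity; [eval_affine | rewrite ?expr1n !mulr1 ?mulrA //].
Qed.

Lemma integral_2c2 s : type_2c2 s ->
  rational_integral (parabola R) (domain_f (den_2c2 R)) s
    ((w - z ^+ 2) ^+ 3 / (8 * z ^+ 3 - 8 * z ^+ 2 * w - 8 * z ^+ 2 - w ^+ 2 - w
              + 10 * z * w) ^+ 2).
Proof.
apply: (@type_f_integral _ _ _ _
  ((X0 ^+ 3 *+ 8 - (X0 ^+ 2 * X1) *+ 8 - (X0 ^+ 2 * X2) *+ 8 - X1 ^+ 2 * X2
   - X1 * X2 ^+ 2 + (X0 * X1 * X2) *+ 10) ^+ 2)) => //.
- by solve_homog.
- by rewrite horner_simp; apply: lt0r_neq0; lra.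
- move=> x; rewrite horner_simp => nz; eval_simp.
  have [x0 x1]  := cubic_den_neq0 nz.
  (* On the parabola the cubic is -9 x^2 (x - 1)^2. *)
  apply: (@eq_neq0 _ ((9 * x ^+ 2 * (x - 1) ^+ 2) ^+ 2)); last by ring.
  by rewrite !(oppr_eq0, mulf_eq0, expf_eq0, pnatr_eq0, negb_or) /= ?x0 ?x1.
- move=> x a b; rewrite !horner_simp => nz; eval_simp.
  have [x0 x1]  := cubic_den_neq0 nz.
  by field; rewrite ?x0 ?x1.
- symmetry; etransitivity; [eval_affine | rewrite ?expr1n !mulr1 ?mulrA //].
Qed.

Lemma integral_2d s : type_2d s ->
  rational_integral (parabola R) (domain_f (den_2d R)) s
    ((w - z ^+ 2) ^+ 3 / ((w + 8 * z ^+ 2) * (z - 1)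
              * (w + 8 * z ^+ 2 + 4 * w ^+ 2 + 5 * w * z ^+ 2 - 14 * z * w
                 - 4 * z ^+ 3))).
Proof.
apply: (@type_f_integral _ _ _ _
  ((X1 * X2 + X0 ^+ 2 *+ 8) * (X0 - X2)
   * (X1 * X2 ^+ 2 + (X0 ^+ 2 * X2) *+ 8 + (X1 ^+ 2 * X2) *+ 4
      + (X1 * X0 ^+ 2) *+ 5 - (X0 * X1 * X2) *+ 14 - X0 ^+ 3 *+ 4))) => //.
- by solve_homog.
- by rewrite horner_simp; apply: lt0r_neq0; lra.
- move=> x; rewrite horner_simp => nz; eval_simp.
  have [x0 x1]  := cubic_den_neq0 nz.
  (* On the parabola the three factors are 9 x^2, x - 1 and 9 x^2 (x - 1)^2. *)
  apply: (@eq_neq0 _ (81 * x ^+ 4 * (x - 1) ^+ 3)); last by ring.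
  by rewrite !(oppr_eq0, mulf_eq0, expf_eq0, pnatr_eq0, negb_or) /= ?x0 ?x1.
- move=> x a b; rewrite !horner_simp => nz; eval_simp.
  have [x0 x1]  := cubic_den_neq0 nz.
  by field; rewrite ?x0 ?x1.
- symmetry; etransitivity; [eval_affine | rewrite ?expr1n !mulr1 ?mulrA //].
Qed.

(** * Type 2a: products of linear forms on the tangent line *)

Lemma prod_nat_rev S N (l : nat -> R) : (N < S)%N ->
  \prod_(1 <= j < N.+1) l (S - j)%N = \prod_((S - N)%N <= k < S) l k.
Proof.
move=> NS; rewrite -[(S - N)%N]add0n big_addn subKn ?(ltnW NS) //.
rewrite -{1}[1%N]add0n big_addn subn1 /=.
rewrite big_nat_rev /= [LHS]big_nat_cond [RHS]big_nat_cond.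
by apply: eq_bigr => i /andP[/andP[_ iN] _]; congr l; lia.
Qed.

Lemma prod_nat_odd N (l : nat -> R) :
  \prod_(0 <= k < (2 * N).+1) l k =
  l 0%N * \prod_(1 <= j < N.+1) (l j * l ((2 * N).+1 - j)%N).
Proof.
rewrite big_split /= prod_nat_rev; last by lia.
have -> : ((2 * N).+1 - N = N.+1)%N by lia.
by rewrite big_ltn // (@big_cat_nat _ _ _ N.+1) //=; lia.
Qed.

(** For even S the index N + 1 = S / 2 is its own partner under j |-> S - j and stays outside the
    pairs, like 0. Its linear form will be the coordinate z. *)
Lemma prod_nat_even N (l : nat -> R) :
  \prod_(0 <= k < (2 * N).+2) l k =
  l 0%N * l N.+1 * \prod_(1 <= j < N.+1) (l j * l ((2 * N).+2 - j)%N).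
Proof.
rewrite big_split /= prod_nat_rev; last by lia.
have -> : ((2 * N).+2 - N = N.+2)%N by lia.
rewrite big_ltn // (@big_cat_nat _ _ _ N.+1) //=; last by lia.
rewrite (@big_ltn _ _ _ N.+1); last by lia.
ring.
Qed.

(* The involution of type 2a permutes these linear forms on the tangent line
   at z0, exchanging the indices k and S - 1 - k. *)
Definition ell (z0 a b : R) (S k : nat) : R := z0 * b + 2 * k%:R / S%:R * a.

(** One formula for both families of constants: 1 - (1 - 2j/S)^-2 = -4j(S - j)/(S - 2j)^2 is c_j for
    S = 2N + 1 and for S = 2N + 2. *)
Definition pencil (S N : nat) : {mpoly R[3]} :=
  \prod_(1 <= j < N.+1)
    (X1 * X2 - (1 - (1 - 2 * j%:R / S%:R) ^- 2) *: X0 ^+ 2).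

Definition pencil_scale (S N : nat) : R :=
  \prod_(1 <= j < N.+1) (1 - 2 * j%:R / S%:R) ^- 2.

Lemma pencil_radius_neq0 S N j : (2 * N < S)%N -> (j < N.+1)%N ->
  1 - 2 * j%:R / S%:R != 0 :> R.
Proof.
move=> NS jN; have S0 : 0 < S%:R :> R by rewrite ltr0n; lia.
rewrite subr_eq0 eq_sym; apply/eqP => h.
have : (2 * j)%:R = S%:R :> R.
  by rewrite natrM; apply: (divIf (lt0r_neq0 S0)); rewrite h divff ?lt0r_neq0.
by move/eqP; rewrite eqr_nat; lia.
Qed.

Lemma pencil_scale_neq0 S N : (2 * N < S)%N -> pencil_scale S N != 0.
Proof.
move=> NS; rewrite /pencil_scale prodf_seq_neq0; apply/allP => j.
rewrite mem_index_iota => /andP[_ jN] /=.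
by rewrite invr_eq0 expf_neq0 // (pencil_radius_neq0 NS).
Qed.

(** On the line z = z0 b + a and w t = z^2 - a^2. With r = 1 - 2j/S the j-th factor is therefore
    r^-2 (z^2 - r^2 a^2), a difference of squares that splits into the linear forms of indices j and
    S - j. The involution pairs the indices differently, so it is the full product over k < S that
    is invariant. *)
Lemma meval_pencil S N z0 a b : (2 * N < S)%N ->
  (pencil S N).@[tvec z0 a b 0] = pencil_scale S N *
    \prod_(1 <= j < N.+1) (ell z0 a b S j * ell z0 a b S (S - j)).
Proof.
move=> NS; rewrite /pencil /pencil_scale meval_prod_nat -big_split /=.
rewrite big_nat_cond [RHS]big_nat_cond; apply: eq_bigr => j.
move=> /andP[/andP[_ jN] _]; eval_simp; rewrite /ell natrB; last by lia.
have r0 := pencil_radius_neq0 NS jN.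
have S0 : S%:R != 0 :> R by rewrite pnatr_eq0; lia.
have -> : 2 * (S%:R - j%:R) / S%:R = 2 - 2 * j%:R / S%:R :> R by field.
by move: r0; set t := 2 * _ / _ => r0; field.
Qed.

(** The new coefficient of a is 2 - 2/S - 2k/S = 2(S - 1 - k)/S; this is where the value of rho
    enters. *)
Lemma ell_involution S k z0 a b : (k < S)%N -> z0 != 0 ->
  ell z0 (- a) (b + (2 - 2 / S%:R) / z0 * a) S k = ell z0 a b S (S - k.+1).
Proof.
move=> kS nz; rewrite /ell natrB // -natr1.
by field; rewrite nz pnatr_eq0; lia.
Qed.

Lemma prod_ell_involution S z0 a b : z0 != 0 ->
  \prod_(0 <= k < S) ell z0 (- a) (b + (2 - 2 / S%:R) / z0 * a) S k =
  \prod_(0 <= k < S) ell z0 a b S k.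
Proof.
move=> nz; rewrite [RHS]big_nat_rev big_nat_cond [RHS]big_nat_cond /=.
by apply: eq_bigr => k /andP[kS _]; rewrite ell_involution.
Qed.

Lemma prod_ell_tangency S z0 : \prod_(0 <= k < S) ell z0 0 1 S k = z0 ^+ S.
Proof.
rewrite (eq_bigr (fun=> z0)) ?prodr_const_nat ?subn0 // => k _.
by rewrite /ell mulr0 addr0 mulr1.
Qed.

Lemma pencil_homog S N : pencil S N \is (2 * N).-homog.
Proof. by apply: homog_prod_nat => j; solve_homog. Qed.

(** The linear form of index 0 is z0 b, while [E] can contain only the coordinate b. The factor z0^m
    makes up for this and cancels on the domain, where z0 is nonzero. *)
Lemma type_2a_integral S s n e m c E (F : ratfun R) :
    (0 < n)%N -> E \is (2 * n).-homog -> c != 0 ->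
    (forall z0 a b, z0 ^+ m * E.@[tvec z0 a b 0] =
       c * (\prod_(0 <= k < S) ell z0 a b S k) ^+ e) ->
    F = affine E ->
  type_2a (2 - 2 / S%:R) s ->
  rational_integral (parabola R) (@domain_2a R) s
    ((rf_w R - rf_z R ^+ 2) ^+ n / F).
Proof.
move=> n0 hE c0 evE -> [_ hs hs']; rewrite -affine_conic.
apply: (@rational_integral_conic _ _ _ (fun z0 => (2 - 2 / S%:R) / z0)) => //.
- by exists 1; exact: oner_neq0.
- by move=> z0 Dz0; have [] := hs z0 Dz0.
- move=> z0 u Dz0; have nz : z0 != 0 := Dz0.
  move: (2 - 2 / S%:R) hs' => r hs' nzu.
  have nzu' : z0 + r * u != 0.
    by apply: contraNneq nzu => h; apply/eqP; apply: (mulIf nz);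
      rewrite mul0r -h; field.
  (* The coordinate zeta = z / z0 equals 1 + u / z0. *)
  have := hs' z0 (1 + u / z0) Dz0.
  have -> : r * (1 + u / z0) - (r - 1) = 1 + r / z0 * u by field.
  move=> /(_ nzu).
  have -> : z0 * (1 + u / z0) = z0 + u by field.
  move=> ->; congr tangent_pt.
  by field; rewrite nz nzu'.
- move=> z0 Dz0; have nz : z0 != 0 := Dz0.
  have := evE z0 0 1; rewrite prod_ell_tangency => h.
  apply: contraTneq isT => E0; move/eqP: h.
  by rewrite E0 mulr0 eq_sym mulf_eq0 (negPf c0) !expf_eq0 (negPf nz) !andbF.
- move=> z0 a b Dz0; have nz : z0 != 0 := Dz0.
  apply: (mulfI (expf_neq0 m nz)).
  by rewrite !evE prod_ell_involution.
Qed.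

(** * Type 2a: the constants c_j and the two integrals *)

Lemma affine_pencil S N : affine (pencil S N) =
  \prod_(1 <= j < N.+1)
    (rf_w R - rf_const (1 - (1 - 2 * j%:R / S%:R) ^- 2) * rf_z R ^+ 2).
Proof.
rewrite /pencil; apply: affine_prod => j.
by cbv beta; etransitivity; [eval_affine | rewrite mulr1].
Qed.

Lemma eq_pencil S N (c : nat -> R) :
    (forall j, (0 < j < N.+1)%N -> c j = 1 - (1 - 2 * j%:R / S%:R) ^- 2) ->
  \prod_(1 <= j < N.+1) (w - rf_const (c j) * z ^+ 2) = affine (pencil S N).
Proof.
move=> hc; rewrite affine_pencil big_nat_cond [RHS]big_nat_cond.
by apply: eq_bigr => j /andP[jN _]; rewrite hc.
Qed.

Lemma integral_2a_odd N s : type_2a (2 - 2 / (2 * N%:R + 1)) s ->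
  rational_integral (parabola R) (@domain_2a R) s
    ((w - z ^+ 2) ^+ (2 * N + 1)
     / \prod_(1 <= j < N.+1)
         (w - rf_const (- (4 * j%:R * (2 * N%:R + 1 - j%:R)
                / (2 * N%:R + 1 - 2 * j%:R) ^+ 2)) * z ^+ 2) ^+ 2).
Proof.
have NS : (2 * N < (2 * N).+1)%N by [].
have SE : (2 * N).+1%:R = 2 * N%:R + 1 :> R by rewrite -natr1 natrM.
(* The factor [X2 ^+ 2] supplies the linear form of index 0 and is 1 in the chart. The product of
   the S forms is squared because S is odd and the power of the conic has even degree. *)
rewrite -SE; apply: (@type_2a_integral _ _ _ 2 2
  (pencil_scale (2 * N).+1 N ^+ 2) (pencil (2 * N).+1 N ^+ 2 * X2 ^+ 2)).
- by rewrite addn1.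
- have := dhomogM (dhomogMn 2 (pencil_homog (2 * N).+1 N))
    (homogX_eq (e := 2) (homogXU_eq _ ord_max erefl) erefl).
  by congr (is_true (_ \is _.-homog)); lia.
- by rewrite expf_neq0 // pencil_scale_neq0.
- move=> z0 a b; rewrite mevalM !mevalXn meval_pencil // mevalXU !mxE /=.
  rewrite prod_nat_odd; set P := \prod_(_ <= _ < _) _; set d := pencil_scale _ _.
  by rewrite /ell mulr0 !mul0r addr0; ring.
- rewrite prodrXl (@eq_pencil (2 * N).+1).
    symmetry; etransitivity; first apply: affineM.
    + by apply: affineXn.
    + by apply: affineXn; exact: affineX2.
    by rewrite expr1n mulr1.
  move=> j /andP[_ jN]; have := pencil_radius_neq0 NS jN; rewrite SE => r0.
  have S0 : 2 * N%:R + 1 != 0 :> R by rewrite -SE pnatr_eq0.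
  have r0' : 2 * N%:R + 1 - 2 * j%:R != 0 :> R.
    apply: contraNneq r0 => h; apply/eqP; apply: (mulIf S0).
    by rewrite mul0r -h; field.
  by field; rewrite r0' S0.
Qed.

Lemma integral_2a_even N s : type_2a (2 - 1 / (N%:R + 1)) s ->
  rational_integral (parabola R) (@domain_2a R) s
    ((w - z ^+ 2) ^+ (N + 1)
     / (z * \prod_(1 <= j < N.+1)
         (w - rf_const (- (j%:R * (2 * N%:R + 2 - j%:R)
                / (N%:R + 1 - j%:R) ^+ 2)) * z ^+ 2))).
Proof.
have NS : (2 * N < (2 * N).+2)%N by [].
have SE : (2 * N).+2%:R = 2 * (N%:R + 1) :> R by rewrite -!natr1 natrM; ring.
have N0 : N%:R + 1 != 0 :> R by rewrite natr1 pnatr_eq0.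
have -> : 2 - 1 / (N%:R + 1) = 2 - 2 / (2 * N).+2%:R :> R.
  by rewrite SE; field.
(* Here [X0] is the linear form of the middle index N + 1, and [X2] supplies that of index 0. *)
apply: (@type_2a_integral _ _ _ 1 1
  (pencil_scale (2 * N).+2 N) (X0 * pencil (2 * N).+2 N * X2)).
- by rewrite addn1.
- have := dhomogM (dhomogM (homogXU_eq _ 0 erefl) (pencil_homog (2 * N).+2 N))
    (homogXU_eq _ ord_max erefl).
  by congr (is_true (_ \is _.-homog)); lia.
- by rewrite pencil_scale_neq0.
- move=> z0 a b; rewrite !mevalM meval_pencil // !mevalXU !mxE /=.
  rewrite prod_nat_even; set P := \prod_(_ <= _ < _) _; set d := pencil_scale _ _.
  by rewrite /ell SE -natr1; field.
- rewrite (@eq_pencil (2 * N).+2).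
    symmetry; etransitivity; first apply: affineM.
    + by apply: affineM; first exact: affineX0.
    + exact: affineX2.
    by rewrite mulr1.
  move=> j /andP[_ jN]; have := pencil_radius_neq0 NS jN; rewrite SE => r0.
  have r0' : N%:R + 1 - j%:R != 0 :> R.
    apply: contraNneq r0 => h; apply/eqP; apply: (mulIf N0).
    by rewrite mul0r -h; field.
  by field; rewrite r0' N0.
Qed.

End Integrals.

Theorem mainTheorem3 (R : realType) :
  let z := rf_z R in
  let w := rf_w R in
  [/\ (forall (rho : R) (s : R -> point R -> point R), type_2a rho s ->
        forall N : nat, (0 < N)%N ->
        (rho = 2 - 2 / (2 * N%:R + 1) ->
           let c (j : nat) : R :=
             - (4 * j%:R * (2 * N%:R + 1 - j%:R)
                / (2 * N%:R + 1 - 2 * j%:R) ^+ 2) in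
           rational_integral (parabola R) (@domain_2a R) s
             ((w - z ^+ 2) ^+ (2 * N + 1)
              / \prod_(1 <= j < N.+1) (w - rf_const (c j) * z ^+ 2) ^+ 2)) /\
        (rho = 2 - 1 / (N%:R + 1) ->
           let c (j : nat) : R :=
             - (j%:R * (2 * N%:R + 2 - j%:R) / (N%:R + 1 - j%:R) ^+ 2) in
           rational_integral (parabola R) (@domain_2a R) s
             ((w - z ^+ 2) ^+ (N + 1)
              / (z * \prod_(1 <= j < N.+1) (w - rf_const (c j) * z ^+ 2))))),
      (forall s : R -> point R -> point R, type_2b1 s ->
        rational_integral (parabola R) (domain_f (den_2b1 R)) s
          ((w - z ^+ 2) ^+ 2
           / ((w + 3 * z ^+ 2) * (z - 1) * (z - w)))) /\
      (forall s : R -> point R -> point R, type_2b2 s ->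
        rational_integral (parabola R) (domain_f (den_2b2 R)) s
          ((w - z ^+ 2) ^+ 2
           / ((z ^+ 2 + w ^+ 2 + w + 1) * (z ^+ 2 + 1)))),
      (forall s : R -> point R -> point R, type_2c1 s ->
        rational_integral (parabola R) (domain_f (den_2c1 R)) s
          ((w - z ^+ 2) ^+ 3 / (1 + w ^+ 3 - 2 * z * w) ^+ 2)) /\
      (forall s : R -> point R -> point R, type_2c2 s ->
        rational_integral (parabola R) (domain_f (den_2c2 R)) s
          ((w - z ^+ 2) ^+ 3
           / (8 * z ^+ 3 - 8 * z ^+ 2 * w - 8 * z ^+ 2 - w ^+ 2 - w
              + 10 * z * w) ^+ 2))
    & (forall s : R -> point R -> point R, type_2d s ->
        rational_integral (parabola R) (domain_f (den_2d R)) s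
          ((w - z ^+ 2) ^+ 3
           / ((w + 8 * z ^+ 2) * (z - 1)
              * (w + 8 * z ^+ 2 + 4 * w ^+ 2 + 5 * w * z ^+ 2 - 14 * z * w
                 - 4 * z ^+ 3))))].
Proof.
move=> z w; split.
- move=> rho s hs N _; split=> rhoE c; subst rho; first exact: integral_2a_odd.
  exact: integral_2a_even.
- by split=> s hs; [exact: integral_2b1 | exact: integral_2b2].
- by split=> s hs; [exact: integral_2c1 | exact: integral_2c2].
- by move=> s hs; exact: integral_2d.
Qed.
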